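(* Let $n\ge 2$, let $1\le p,q<\infty$, and let $m_{p,q}:S_{\ell_p^n}\to S_{\ell_q^n}$ be the Mazur map $$m_{p,q}(x)=\bigl(|x_1|^{p/q}\operatorname{sign}(x_1),\dots,|x_n|^{p/q}\operatorname{sign}(x_n)\bigr).$$ Then the following (Mazur) estimates for $m_{p,q}$ are all sharp: (i) if $1\le q<p<\infty$, then $\omega_{m_{p,q}}(t)\le \frac pq\,t$ and $\rho_{m_{p,q}}(t)\ge 2^{1-\frac pq}t^{\frac pq}$ for $0\le t\le 2$; (ii) if $1\le p\le q<\infty$, then $\omega_{m_{p,q}}(t)\le 2^{1-\frac pq}t^{\frac pq}$ and $\rho_{m_{p,q}}(t)\ge\frac pq\,t$ for $0\le t\le 2$. Here an upper estimate $\omega_{m_{p,q}}(t)\le Ct^{\gamma}$ ($0\le t\le2$) is called sharp if $C$ is the least constant for which it holds with exponent $\gamma$, and for no $\gamma'>\gamma$ and $C'<\infty$ does $\omega_{m_{p,q}}(t)\le C't^{\gamma'}$ hold for all $0\le t\le 2$; a lower estimate $\rho_{m_{p,q}}(t)\ge ct^{\gamma}$ ($0\le t\le2$) is called sharp if $c$ is the largest constant for which it holds with exponent $\gamma$, and for no $\gamma'<\gamma$ and $c'>0$ does $\rho_{m_{p,q}}(t)\ge c't^{\gamma'}$ hold for all $0\le t\le 2$.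
   Context: $\ell_p^n$ denotes $\mathbb C^n$ with the $\ell_p$ norm; $S_{\ell_p^n}$ is its unit sphere with the metric $d(x,y)=\|x-y\|_p$. For $z\in\mathbb C$, $\operatorname{sign}(z)=z/|z|$ if $z\ne0$ and $\operatorname{sign}(0)=0$. For a map $f:(\mathcal M,d_{\mathcal M})\to(\mathcal N,d_{\mathcal N})$ between metric spaces, $\omega_f(t)=\sup\{d_{\mathcal N}(f(x),f(y)): d_{\mathcal M}(x,y)\le t\}$ and $\rho_f(t)=\inf\{d_{\mathcal N}(f(x),f(y)): d_{\mathcal M}(x,y)\ge t\}$. *)

(* Defs.v *)
From HB Require Import structures.
From mathcomp Require Import all_boot all_order all_algebra.
From mathcomp Require Import complex.
From mathcomp Require Import all_classical all_reals all_analysis.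

Set Implicit Arguments.
Unset Strict Implicit.
Unset Printing Implicit Defensive.

Import Order.TTheory GRing.Theory Num.Theory.

Local Open Scope classical_set_scope.
Local Open Scope ring_scope.

Section LpNorm.
Context {R : realType}.
Implicit Types (p q : R) (z w : R[i]).

(* The modulus of a complex number as an element of [R]; the generic norm
   [`|z|] on [R[i]] is again an element of [R[i]]. *)
Definition cabs z : R := ComplexField.Normc.normc z.

Definition csign z : R[i] :=
  if z == 0 then 0 else z / (real_complex R (cabs z)).

Definition lpnorm n p (x : 'rV[R[i]]_n) : R :=
  (\sum_(i < n) cabs (x 0 i) `^ p) `^ p^-1.

Lemma cabs_ge0 z : 0 <= cabs z.
Proof. by case: z => a b; apply: sqrtr_ge0. Qed.

Lemma cabs0 : cabs 0 = 0.
Proof. exact: ComplexField.Normc.normc0. Qed.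

Lemma cabs_eq0 z : cabs z = 0 -> z = 0.
Proof. exact: ComplexField.Normc.eq0_normc. Qed.

Lemma cabsM z w : cabs (z * w) = cabs z * cabs w.
Proof. exact: ComplexField.Normc.normcM. Qed.

Lemma cabsV z : cabs z^-1 = (cabs z)^-1.
Proof. exact: ComplexField.Normc.normcV. Qed.

Lemma cabsR (a : R) : 0 <= a -> cabs (real_complex R a) = a.
Proof. by move=> a0; rewrite /cabs/= expr0n/= addr0 sqrtr_sqr ger0_norm. Qed.

Lemma cabsD z w : cabs (z + w) <= cabs z + cabs w.
Proof. exact: le_normcD. Qed.

Lemma cabsN z : cabs (- z) = cabs z.
Proof. exact: normcN. Qed.

Lemma cabs_sign z : z != 0 -> cabs (csign z) = 1.
Proof.
move=> z0; rewrite /csign (negbTE z0) cabsM cabsV cabsR ?cabs_ge0// divff//.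
by apply: contra z0 => /eqP/cabs_eq0 ->.
Qed.

Lemma lpnorm_ge0 n p (x : 'rV[R[i]]_n) : 0 <= lpnorm p x.
Proof. exact: powR_ge0. Qed.

Lemma sum_powR_ge0 n p (x : 'rV[R[i]]_n) : 0 <= \sum_i cabs (x 0 i) `^ p.
Proof. by apply: sumr_ge0 => i _; apply: powR_ge0. Qed.

Lemma lpnormX n p (x : 'rV[R[i]]_n) : 0 < p ->
  lpnorm p x `^ p = \sum_i cabs (x 0 i) `^ p.
Proof.
move=> p0; rewrite /lpnorm -powRrM mulVf ?gt_eqF// powRr1//.
exact: sum_powR_ge0.
Qed.

Lemma lpnorm_eq1 n p (x : 'rV[R[i]]_n) : 0 < p ->
  (lpnorm p x == 1) = (\sum_i cabs (x 0 i) `^ p == 1).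
Proof.
move=> p0; rewrite /lpnorm powR_eq1 invr_eq0 (gt_eqF p0) orbF.
by rewrite ltNge sum_powR_ge0 orbF.
Qed.

Lemma lpnorm0 n p : 0 < p -> lpnorm p (0 : 'rV[R[i]]_n) = 0.
Proof.
move=> p0; rewrite /lpnorm big1 ?powR0 ?invr_eq0 ?gt_eqF// => i _.
by rewrite mxE cabs0 powR0// gt_eqF.
Qed.

Lemma lpnorm_eq0 n p (x : 'rV[R[i]]_n) : 0 < p -> lpnorm p x = 0 -> x = 0.
Proof.
move=> p0 /powR_eq0_eq0/eqP.
rewrite psumr_eq0 => [/allP x0|i _]; last exact: powR_ge0.
apply/rowP => i; rewrite mxE.
have /implyP/(_ isT)/eqP := x0 i (mem_index_enum i).
by move/powR_eq0_eq0/cabs_eq0.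
Qed.

Lemma lpnormN n p (x : 'rV[R[i]]_n) : lpnorm p (- x) = lpnorm p x.
Proof.
by rewrite /lpnorm; congr (_ `^ _); apply: eq_bigr => i _; rewrite mxE cabsN.
Qed.

Lemma lpnormD n p (x y : 'rV[R[i]]_n) : 1 <= p ->
  lpnorm p (x + y) <= lpnorm p x + lpnorm p y.
Proof.
move=> p1; have p0 : 0 < p := lt_le_trans ltr01 p1.
have [/(lpnorm_eq0 p0) ->|x0] := eqVneq (lpnorm p x) 0.
  by rewrite add0r lpnorm0// add0r.
have [/(lpnorm_eq0 p0) ->|y0] := eqVneq (lpnorm p y) 0.
  by rewrite addr0 lpnorm0// addr0.
set a := lpnorm p x; set b := lpnorm p y.
have a0 : 0 < a by rewrite lt_neqAle eq_sym x0 lpnorm_ge0.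
have b0 : 0 < b by rewrite lt_neqAle eq_sym y0 lpnorm_ge0.
have aX : a `^ p = \sum_i cabs (x 0 i) `^ p := lpnormX x p0.
have bX : b `^ p = \sum_i cabs (y 0 i) `^ p := lpnormX y p0.
clearbody a b; have ab0 : 0 < a + b := addr_gt0 a0 b0.
suff H : \sum_i cabs ((x + y) 0 i) `^ p <= (a + b) `^ p.
  have pV0 : 0 <= p^-1 by rewrite invr_ge0 ltW.
  apply: (le_trans (ge0_ler_powR pV0 _ _ H)); rewrite ?nnegrE ?powR_ge0//.
    exact: sum_powR_ge0.
  by rewrite -powRrM divff ?gt_eqF// powRr1// ltW.
have t01 : 0 <= a / (a + b) <= 1.
  by apply/andP; split; rewrite ?divr_ge0 ?ler_pdivrMr ?mul1r ?lerDl
    ?(ltW a0) ?(ltW b0) ?(ltW ab0).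
have tE : 1 - a / (a + b) = b / (a + b).
  by rewrite -[X in X - _](divff (lt0r_neq0 ab0)) -mulrBl addrAC subrr add0r.
have cancel_ab (c d : R) : 0 < c -> (a + b) * (c / (a + b) * (d / c)) = d.
  move=> c0; rewrite mulrA (mulrC (a + b)) divfK ?gt_eqF//.
  by rewrite mulrC divfK// gt_eqF.
have powRV (c d : R) : 0 <= c -> 0 < d -> c `^ p / d `^ p = (c / d) `^ p.
  move=> c0 d0; have d0' := ltW d0.
  rewrite powRM ?invr_ge0//; congr (_ * _).
  by rewrite -(powR_inv1 d0') -(powR_inv1 (powR_ge0 d p)) powRAC.
have key i : cabs ((x + y) 0 i) `^ p <= (a + b) `^ p *
    (a / (a + b) * (cabs (x 0 i) `^ p / a `^ p)
    + b / (a + b) * (cabs (y 0 i) `^ p / b `^ p)).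
  have u0 : 0 <= cabs (x 0 i) / a by rewrite divr_ge0 ?cabs_ge0// ltW.
  have v0 : 0 <= cabs (y 0 i) / b by rewrite divr_ge0 ?cabs_ge0// ltW.
  have uv0 : 0 <= a / (a + b) * (cabs (x 0 i) / a)
      + b / (a + b) * (cabs (y 0 i) / b).
    by rewrite addr_ge0// mulr_ge0// divr_ge0 ?(ltW a0) ?(ltW b0) ?(ltW ab0).
  have cvx : (a / (a + b) * (cabs (x 0 i) / a)
        + b / (a + b) * (cabs (y 0 i) / b)) `^ p <=
      a / (a + b) * (cabs (x 0 i) / a) `^ p
        + b / (a + b) * (cabs (y 0 i) / b) `^ p.
    rewrite -tE; have /andP[t0 t1] := t01.
    by apply: (@convex_powR R p p1 (Itv01 t0 t1));
      rewrite inE/= in_itv/= ?u0 ?v0.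
  rewrite !powRV ?cabs_ge0//.
  apply: (@le_trans _ _ ((a + b) `^ p * (a / (a + b) * (cabs (x 0 i) / a)
      + b / (a + b) * (cabs (y 0 i) / b)) `^ p)); last first.
    by rewrite ler_wpM2l ?powR_ge0.
  rewrite -powRM ?(ltW ab0)// mxE ge0_ler_powR ?nnegrE ?cabs_ge0 ?(ltW p0)//.
    by rewrite mulr_ge0 ?(ltW ab0).
  apply: (le_trans (cabsD _ _)); rewrite mulrDr.
  by rewrite !cancel_ab.
apply: (le_trans (ler_sum _ (fun i _ => key i))).
rewrite -mulr_sumr big_split/= -!mulr_sumr -!mulr_suml -aX -bX.
by rewrite !divff ?gt_eqF ?powR_gt0// !mulr1 -mulrDl divff ?gt_eqF// mulr1.
Qed.

End LpNorm.

Record sphere (R : realType) (n : nat) (p : R) (hp : 1 <= p) := Sphere {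
  sphere_val :> 'rV[R[i]]_n;
  sphere_valP : lpnorm p sphere_val == 1 }.

HB.instance Definition _ (R : realType) n (p : R) (hp : 1 <= p) :=
  [isSub for @sphere_val R n p hp].
HB.instance Definition _ (R : realType) n (p : R) (hp : 1 <= p) :=
  [Choice of sphere n hp by <:].

Section SphereMetric.
Context (R : realType) (n : nat) (p : R) (hp : 1 <= p).
Implicit Types x y : sphere n hp.

Definition sphere_dist x y : R :=
  lpnorm p (sphere_val x - sphere_val y).

Let p0 : 0 < p := lt_le_trans ltr01 hp.

Let sphere_distxx x : sphere_dist x x = 0.
Proof. by rewrite /sphere_dist subrr lpnorm0. Qed.

Let sphere_dist_positivity x y : sphere_dist x y = 0 -> x = y.
Proof. by move/(lpnorm_eq0 p0)/eqP; rewrite subr_eq0 => /eqP/val_inj. Qed.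

Let sphere_dist_sym x y : sphere_dist x y = sphere_dist y x.
Proof. by rewrite /sphere_dist -lpnormN opprB. Qed.

Let sphere_dist_triangle y x z :
  sphere_dist x z <= sphere_dist x y + sphere_dist y z.
Proof.
have := lpnormD (sphere_val x - sphere_val y) (sphere_val y - sphere_val z) hp.
by rewrite addrA subrK; apply.
Qed.

HB.instance Definition _ := @isMetric.Build R (sphere n hp) sphere_dist
  sphere_distxx sphere_dist_positivity sphere_dist_sym sphere_dist_triangle.

Lemma mdist_sphereE x y : mdist x y = lpnorm p (sphere_val x - sphere_val y).
Proof. reflexivity. Qed.

End SphereMetric.

Section Mazur.
Context (R : realType) (n : nat) (p q : R) (hp : 1 <= p) (hq : 1 <= q).

Definition mazur_vec (x : 'rV[R[i]]_n) : 'rV[R[i]]_n :=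
  \row_(i < n) (real_complex R (cabs (x 0 i) `^ (p / q)) * csign (x 0 i)).

Lemma mazur_subproof (x : sphere n hp) : lpnorm q (mazur_vec x) == 1.
Proof.
have p0 : 0 < p := lt_le_trans ltr01 hp.
have q0 : 0 < q := lt_le_trans ltr01 hq.
have x1 := eqP (etrans (esym (lpnorm_eq1 x p0)) (sphere_valP x)).
rewrite (lpnorm_eq1 _ q0) -x1; apply/eqP.
apply: eq_bigr => i _; rewrite mxE cabsM cabsR ?powR_ge0//.
have [->|x0] := eqVneq (sphere_val x 0 i) 0.
  by rewrite cabs0 !powR0 ?mul0r ?powR0// gt_eqF// divr_gt0.
by rewrite cabs_sign// mulr1 -powRrM mulfVK// gt_eqF.
Qed.

Definition mazur (x : sphere n hp) : sphere n hq :=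
  Sphere hq (mazur_subproof x).

End Mazur.

(* The supremum and infimum are taken in [\bar R], so that neither boundedness
   nor nonemptiness has to be presupposed. *)
Definition omega (R : realType) (M N : metricType R) (f : M -> N) (t : R) :
    \bar R :=
  ereal_sup [set e | exists x y : M,
    mdist x y <= t /\ e = (mdist (f x) (f y))%:E].

Definition rho (R : realType) (M N : metricType R) (f : M -> N) (t : R) :
    \bar R :=
  ereal_inf [set e | exists x y : M,
    t <= mdist x y /\ e = (mdist (f x) (f y))%:E].

Section Sharpness.
Context (R : realType).
Implicit Types (w : R -> \bar R) (C g : R).

Definition upper_estimate w C g : Prop :=
  forall t : R, 0 <= t <= 2 -> (w t <= (C * t `^ g)%:E)%E.

Definition lower_estimate w C g : Prop :=
  forall t : R, 0 <= t <= 2 -> ((C * t `^ g)%:E <= w t)%E.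

(* These assert only optimality, not the estimate itself. *)
Definition upper_sharp w C g : Prop :=
  (forall C' : R, upper_estimate w C' g -> C <= C') /\
  (forall g' C' : R, g < g' -> ~ upper_estimate w C' g').

Definition lower_sharp w C g : Prop :=
  (forall C' : R, lower_estimate w C' g -> C' <= C) /\
  (forall g' C' : R, g' < g -> 0 < C' -> ~ lower_estimate w C' g').

End Sharpness.

(* Main.v *)
Require Import Defs.
From mathcomp Require Import all_boot all_order all_algebra.
From mathcomp Require Import complex.
From mathcomp Require Import all_classical all_reals all_analysis.
From mathcomp Require Import ring lra.
Import Order.TTheory GRing.Theory Num.Theory.
Local Open Scope ring_scope.
Import numFieldNormedType.Exports.

Set Implicit Arguments.
Unset Strict Implicit.

(** Put [a = p / q].  The Mazur map acts on each coordinate by the radial power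
[z |-> |z|^a sign z], so the two estimates for [q <= p] come from two
inequalities between complex numbers, summed over the coordinates.  The
inverse of the Mazur map is the Mazur map with [p] and [q] exchanged, and this
turns the two estimates for [q <= p] into the two estimates for [p <= q].

Pointwise, the angle between [z] and [w] can be removed: if [r = |z|] and
[s = |w|], there is [l] in [0, 1], depending only on the angle, such that the
images of [z] and [w] are at squared distance
[l (r^a - s^a)^2 + (1 - l) (r^a + s^a)^2] for every [a <> 0], in particular for
[a = 1] ([radial_power_dist]).  It is then enough to treat the two collinear
positions.

- Expansion ([radial_power_expand]): the distance of the images is at least
  [2^(1 - a) |z - w|^a].  This is convexity of the power [a >= 1] in [l],
  together with superadditivity for [l = 1] and midpoint convexity for [l = 0].
  Raised to the power [q] and summed, it gives the lower estimate directly.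

- Lipschitz bound ([radial_power_lipschitz]): the distance of the images is at
  most [a |z - w| A^((a - 1) / p)], where [A] is the mean of [r^p] and [s^p].
  On the real line this bounds the mean value of [x^(a - 1)] on [[s, r]]
  ([powR_sub_le_mean]): the function [x^(a - 1)] is the power [(a - 1) / p] of
  [x^p], a concave power, and the mean value of the convex function [x^p] is at
  most the mean of its values at the endpoints.  The exponent of [A] is the one
  for which summing the power [q] over the coordinates is an instance of
  Hölder's inequality: the sum of the means [A] is 1 on the sphere, so only
  the factor [p / q] remains ([mazur_vec_lipschitz]).

For sharpness, all four claims follow from pairs of points whose distance [s]
tends to 0 and for which the ratio (distance of the images) / [s^g] tends to
the claimed constant: an estimate with exponent [g] then bounds the constant by
this limit, and another exponent would force the ratio to 0 or to infinity
([sharp_of_family]).  Two families suffice, both supported on two coordinates.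
The points [(h, b)] and [(-h, b)] have distance [2 h] and images at distance
[2 h^a] ([sharp_opposite]).  The two points whose coordinates have [p]-th powers
[(1 + h) / 2] and [(1 - h) / 2], in either order, are at distance
[(1 + h)^(1/p) - (1 - h)^(1/p)], and their images at the same distance with [q]
in place of [p], so that the ratio tends to [p / q] ([sharp_swap]). *)

(** * Inequalities for real powers *)

Section RealInequalities.
Context {R : realType}.
Implicit Types (a p r s t x y : R).

(** Bernoulli's inequality for a concave power. *)
Lemma powR_le_affine x t :
  0 <= x -> 0 <= t <= 1 -> x `^ t <= t * x + (1 - t).
Proof.
move=> x0 /andP[]; rewrite le_eqVlt => /predU1P[<- _|t0].
  by rewrite powRr0 mul0r add0r subr0.
rewrite le_eqVlt => /predU1P[->|t1].
  by rewrite powRr1// mul1r subrr addr0.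
have t1' : 0 < 1 - t by rewrite subr_gt0.
have := @conjugate_powR R (x `^ t) 1 t^-1 (1 - t)^-1 (powR_ge0 _ _) ler01.
rewrite !invr_gt0 !invrK subrKC mulr1 powR1 mul1r => /(_ t0 t1' erefl).
by rewrite -powRrM divff ?gt_eqF// powRr1// mulrC.
Qed.

(** Weighted arithmetic-geometric mean inequality, by homogeneity from
[powR_le_affine]. *)
Lemma powR_young x y t :
  0 <= x -> 0 <= y -> 0 <= t <= 1 ->
  x `^ t * y `^ (1 - t) <= t * x + (1 - t) * y.
Proof.
move=> x0; rewrite le_eqVlt => /predU1P[<- /andP[t0 t1]|y0 t01].
  have [->|tn1] := eqVneq t 1.
    by rewrite subrr powRr0 powRr1// mulr1 mul1r mul0r addr0.
  by rewrite powR0 ?subr_eq0 1?eq_sym// !mulr0 addr0 mulr_ge0.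
have y0' := ltW y0.
have := powR_le_affine (divr_ge0 x0 y0') t01.
rewrite -(ler_pM2r y0) => /le_trans-/(_ (t * x + (1 - t) * y)).
rewrite mulrDl mulrA divfK ?gt_eqF// lexx => /(_ isT).
rewrite powRM ?invr_ge0// -mulrA; suff -> : y^-1 `^ t * y = y `^ (1 - t) by [].
rewrite powRB ?(gt_eqF y0) ?implybT// powRr1//.
by rewrite -[X in X `^ t]powR_inv1// powRAC powR_inv1 ?powR_ge0// mulrC.
Qed.

(** The tangent at [r] lies below the convex power: this is [powR_young] for
[s^p] and [r^p] with weight [1 / p]. *)
Lemma powR_tangent p r s : 1 <= p -> 0 <= s -> 0 < r ->
  r `^ p + p * r `^ (p - 1) * (s - r) <= s `^ p.
Proof.
move=> p1 s0 r0; have p0 : 0 < p := lt_le_trans ltr01 p1.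
have pV : 0 <= p^-1 <= 1 by rewrite invr_ge0 ltW//= invf_le1.
have := powR_young (powR_ge0 s p) (powR_ge0 r p) pV.
rewrite -!powRrM divff ?gt_eqF// powRr1// mulrBr mulr1 divff ?gt_eqF//.
rewrite -(ler_pM2l p0) mulrDr !mulrA divff ?gt_eqF// mul1r.
rewrite mulrBr mulr1 divff ?gt_eqF// => H.
have rE : r * r `^ (p - 1) = r `^ p by rewrite mulr_powRB1// ltW.
by move: H; rewrite -rE; nra.
Qed.

Lemma is_derive_powR_comb (al be ga a b x : R) : 0 < x ->
  is_derive x 1 (fun x => al * x `^ a + be * x `^ b + ga * x)
    (al * (a * x `^ (a - 1)) + be * (b * x `^ (b - 1)) + ga).
Proof.
move=> x0; have := is_deriveZ ga (is_derive_id x (1 : R)).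
rewrite /GRing.scale/= mulr1 => did.
exact: (is_deriveD (is_deriveD (is_deriveZ al (is_derive1_powR a x0))
  (is_deriveZ be (is_derive1_powR b x0))) did).
Qed.

(** Integration of a pointwise inequality between powers, in the form in which
the two lemmas below need it: the derivative of a combination of two powers and
a linear term is nonnegative. *)
Lemma powR_comb_ndecr (al be ga a b s r : R) : 0 < s -> s <= r ->
  (forall x, s <= x <= r ->
    0 <= al * (a * x `^ (a - 1)) + be * (b * x `^ (b - 1)) + ga) ->
  al * s `^ a + be * s `^ b + ga * s <= al * r `^ a + be * r `^ b + ga * r.
Proof.
move=> s0 sr df0; rewrite -subr_ge0.
have pos x : x \in `[s, r] -> 0 < x.
  by rewrite in_itv/= => /andP[+ _]; exact: lt_le_trans.
have [||c cI ->] := @MVT_segment R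
  (fun x => al * x `^ a + be * x `^ b + ga * x)
  (fun x => al * (a * x `^ (a - 1)) + be * (b * x `^ (b - 1)) + ga) s r sr.
- move=> x xI; apply: is_derive_powR_comb; apply: pos.
  by move: xI; rewrite !in_itv/= => /andP[? ?]; rewrite !ltW.
- apply: derivable_within_continuous => x /pos x0.
  by case: (is_derive_powR_comb al be ga a b x0).
by rewrite mulr_ge0 ?subr_ge0// df0//; move: cI; rewrite in_itv.
Qed.

(** The trapezoidal rule overestimates the integral of the convex function
[x^p] on [[s, r]].  The difference of the two sides increases with [r] because
of [powR_tangent]. *)
Lemma powR_trapezoid p r s : 1 <= p -> 0 < s -> s <= r ->
  (r `^ (p + 1) - s `^ (p + 1)) / (p + 1) <= (r - s) * ((r `^ p + s `^ p) / 2).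
Proof.
move=> p1 s0 sr; have p0 : 0 < p + 1 by lra.
have r0 : 0 < r by lra.
have pS x : 0 < x -> x * x `^ p = x `^ (p + 1).
  by move=> x0; rewrite -[in LHS](addrK 1 p) mulr_powRB1// ltW.
have df_ge0 x : s <= x <= r -> 0 <= (1 - 2 / (p + 1)) *
    ((p + 1) * x `^ (p + 1 - 1)) + - s * (p * x `^ (p - 1)) + s `^ p.
  move=> /andP[sx _]; have x0 : 0 < x by lra.
  have := @powR_tangent p x s p1 (ltW s0) x0.
  have -> y : (1 - 2 / (p + 1)) * ((p + 1) * y) = (p - 1) * y.
    by field; rewrite gt_eqF.
  rewrite addrK -[x `^ p](mulr_powRB1 (ltW x0)); last lra.
  by nra.
have := powR_comb_ndecr s0 sr df_ge0; rewrite -!(pS _ s0) -!(pS _ r0).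
move: (s `^ p) (r `^ p) (p + 1)^-1 => S T u; lra.
Qed.

(** The left-hand side is [a] times the integral of [x^(a - 1)] on [[s, r]].
With [A] the mean of [r^p] and [s^p] and [b = (a - 1) / p], concavity of the
power [b] bounds [x^(a - 1)] by its tangent at [A] as a function of [x^p]; by
[powR_trapezoid] the mean value of [x^p] is at most [A], and there the tangent
takes the value [A^b]. *)
Lemma powR_sub_le_mean a p r s :
  1 <= a -> a - 1 <= p -> 1 <= p -> 0 <= s -> s <= r ->
  r `^ a - s `^ a <= a * (r - s) * ((r `^ p + s `^ p) / 2) `^ ((a - 1) / p).
Proof.
move=> a1 ap p1 s0 sr; have p0 : 0 < p by lra.
set b := (a - 1) / p.
have b01 : 0 <= b <= 1.
  rewrite /b ler_pdivrMr// mul1r ap andbT.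
  by rewrite divr_ge0 ?subr_ge0// ltW.
have pb : p * b = a - 1 by rewrite /b mulrC divfK// gt_eqF.
have [r0|r0] := leP r 0.
  have -> : r = s by lra.
  by rewrite !subrr mulr0 mul0r.
have a0 : a != 0 by rewrite gt_eqF//; lra.
(* At [s = 0] the derivative of a power need not exist; the inequality reads
   [2^b <= a] there. *)
have [s00|sn0] := leP s 0.
  have -> : s = 0 by lra.
  rewrite !powR0 ?(gt_eqF p0)// subr0 addr0 subr0 powRM ?powR_ge0 ?invr_ge0//.
  rewrite -powRrM pb.
  have -> : r `^ a = r * r `^ (a - 1) by rewrite mulr_powRB1// ?ltW//; lra.
  have ra0 := powR_ge0 r (a - 1).
  suff H : 1 <= a * 2^-1 `^ b.
    rewrite [X in _ <= X](_ : _ = (a * 2^-1 `^ b) * (r * r `^ (a - 1))).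
      by rewrite ler_peMl// mulr_ge0// ltW.
    by ring.
  rewrite -powR_inv1// powRAC powR_inv1 ?powR_ge0// ler_pdivlMr ?powR_gt0//.
  rewrite mul1r.
  have b_le : b <= a - 1 by rewrite /b ler_pdivrMr//; nra.
  have : 2 `^ b <= b * 2 + (1 - b) by apply: powR_le_affine.
  lra.
have rp := powR_gt0 p r0; have sp := powR_gt0 p sn0.
set A := (_ / 2); have A0 : 0 < A by rewrite /A; lra.
set K := A `^ b; have K0 : 0 < K by apply: powR_gt0.
(* The tangent bound for [x^(a - 1)]. *)
have yg x : 0 < x -> x `^ (a - 1) <= K * (b * (x `^ p / A) + (1 - b)).
  move=> x0; have xp := powR_gt0 p x0.
  have := powR_young (ltW xp) (ltW A0) b01.
  have AK : 0 < K / A by rewrite divr_gt0.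
  rewrite -powRrM [X in X <= _](_ : _ = x `^ (a - 1) * (A / K)); last first.
    by rewrite powRB ?(gt_eqF A0) ?implybT// powRr1 ?(ltW A0)// pb.
  rewrite -(ler_pM2r AK) => H.
  rewrite [X in X <= _](_ : _ = x `^ (a - 1) * (A / K) * (K / A)).
    rewrite [X in _ <= X](_ : _ = (b * x `^ p + (1 - b) * A) * (K / A))//.
    by field; rewrite gt_eqF.
  by field; rewrite !gt_eqF.
have trap := powR_trapezoid p1 sn0 sr; rewrite -/A in trap.
have p1' : 0 < p + 1 by lra.
have a0' : 0 < a by lra.
have df_ge0 x : s <= x <= r -> 0 <= K * (b / (A * (p + 1))) *
    ((p + 1) * x `^ (p + 1 - 1)) + - a^-1 * (a * x `^ (a - 1)) + K * (1 - b).
  move=> /andP[sx _]; have x0 : 0 < x by lra.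
  rewrite addrK mulNr mulKf// addrAC subr_ge0.
  have -> : K * (b / (A * (p + 1))) * ((p + 1) * x `^ p) =
    K * (b * (x `^ p / A)) by field; rewrite !gt_eqF.
  by rewrite -mulrDr yg.
have H := powR_comb_ndecr sn0 sr df_ge0.
rewrite -[X in _ <= X](mulfVK a0) -[X in X <= _](mulfVK a0) ler_pM2r//.
have : K * (b / A) * ((r `^ (p + 1) - s `^ (p + 1)) / (p + 1)) <=
    K * (b / A) * ((r - s) * A).
  case/andP: b01 => b0 _; have b0' : 0 <= K * (b / A).
    by apply: mulr_ge0 (ltW K0) _; apply: divr_ge0 b0 (ltW A0).
  by rewrite ler_wpM2l.
have -> : K * (b / A) * ((r - s) * A) = K * b * (r - s).
  by field; rewrite gt_eqF.
have -> : a * (r - s) * K / a = K * (r - s) by field.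
have <- : K * (b / (A * (p + 1))) * (r `^ (p + 1) - s `^ (p + 1)) =
  K * (b / A) * ((r `^ (p + 1) - s `^ (p + 1)) / (p + 1)).
  by field; rewrite !gt_eqF.
lra.
Qed.

(** Each of the two summands [x^a] on the left is at most [x r^(a - 1)]. *)
Lemma powR_superadditive a r s : 1 <= a -> 0 <= s -> s <= r ->
  (r - s) `^ a + s `^ a <= r `^ a.
Proof.
move=> a1 s0 sr; have a0 : 0 < a by lra.
have r0 : 0 <= r by lra.
have rs0 : 0 <= r - s by lra.
have mono x : 0 <= x -> x <= r -> x `^ a <= x * r `^ (a - 1).
  move=> x0 xr; rewrite -(mulr_powRB1 x0 a0) ler_wpM2l//.
  by apply: ge0_ler_powR; rewrite ?nnegrE//; lra.
have := lerD (mono _ rs0 (_ : r - s <= r)) (mono _ s0 sr).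
by rewrite -mulrDl subrK mulr_powRB1//; apply; lra.
Qed.

Lemma powR_convex a l x y : 1 <= a -> 0 <= l <= 1 -> 0 <= x -> 0 <= y ->
  (l * x + (1 - l) * y) `^ a <= l * x `^ a + (1 - l) * y `^ a.
Proof.
move=> a1 /andP[l0 l1] x0 y0.
by apply: (@convex_powR R a a1 (Itv01 l0 l1)); rewrite inE/= in_itv/= andbT.
Qed.

Lemma powR_midpoint a r s : 1 <= a -> 0 <= r -> 0 <= s ->
  2 `^ (1 - a) * (r + s) `^ a <= r `^ a + s `^ a.
Proof.
move=> a1 r0 s0; have h01 : 0 <= (2^-1 : R) <= 1 by lra.
have := powR_convex a1 h01 r0 s0; have -> : 1 - 2^-1 = 2^-1 :> R by lra.
rewrite -!mulrDr powRM ?invr_ge0 ?addr_ge0// => H.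
rewrite powRB ?(gt_eqF _ : 0 < 2)%R ?pnatr_eq0 ?implybT// powRr1//.
rewrite -mulrA -(ler_pM2l (_ : 0 < 2^-1)) ?invr_gt0// mulKf//.
by rewrite -[X in X^-1]/(2 `^ a) -powR_inv1 ?powR_ge0// powRAC powR_inv1.
Qed.

End RealInequalities.

(** * Radial powers of complex numbers *)

Section ComplexPlane.
Context {R : realType}.
Implicit Types (z w e f : R[i]) (a r s : R).

Lemma sqr_cabs (x y : R) : cabs (x +i* y)%C ^+ 2 = x ^+ 2 + y ^+ 2.
Proof. by rewrite /cabs/= sqr_sqrtr// addr_ge0 ?sqr_ge0. Qed.

(** With [c] the cosine of the angle between [e] and [f], the left-hand side is
[r^2 + s^2 - 2 r s c], and [l = (1 + c) / 2].  The point is that [l] does not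
depend on [r] and [s]. *)
Lemma sqr_cabs_sub_unit e f : cabs e = 1 -> cabs f = 1 ->
  exists2 l : R, 0 <= l <= 1 & forall r s,
    cabs (real_complex R r * e - real_complex R s * f) ^+ 2 =
    l * (r - s) ^+ 2 + (1 - l) * (r + s) ^+ 2.
Proof.
move=> /(congr1 (fun x => x ^+ 2)) + /(congr1 (fun x => x ^+ 2)).
case: e f => [a b] [c d]; rewrite !sqr_cabs expr1n => e1 f1.
exists ((1 + (a * c + b * d)) / 2).
  have := sqr_ge0 (a - c); have := sqr_ge0 (b - d).
  have := sqr_ge0 (a + c); have := sqr_ge0 (b + d).
  nra.
move=> r s.
rewrite [X in cabs X](_ : _ = ((r * a - s * c) +i* (r * b - s * d))%C).
  rewrite sqr_cabs.
  rewrite [LHS](_ : _ = r ^+ 2 * (a ^+ 2 + b ^+ 2) + s ^+ 2 * (c ^+ 2 + d ^+ 2)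
    - 2 * r * s * (a * c + b * d)); last by ring.
  by rewrite e1 f1; field.
by apply/eqP; rewrite eq_complex/= !mul0r !subr0 !addr0 !eqxx.
Qed.

Definition radial_power a z : R[i] :=
  real_complex R (cabs z `^ a) * csign z.

Lemma cabs_csignK z : real_complex R (cabs z) * csign z = z.
Proof.
rewrite /csign; have [->|z0] := eqVneq z 0; first by rewrite mulr0.
rewrite mulrC divfK//; apply: contra z0 => /eqP/(congr1 cabs).
by rewrite cabsR ?cabs_ge0// cabs0 => /cabs_eq0 ->.
Qed.

(** A direction [e] that serves for every exponent; at [z = 0], where [csign]
vanishes, any unit vector will do. *)
Lemma radial_power_polar z : exists2 e, cabs e = 1 &
  z = real_complex R (cabs z) * e /\
  forall a, a != 0 -> radial_power a z = real_complex R (cabs z `^ a) * e.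
Proof.
have [->|z0] := eqVneq z 0.
  exists 1; first by rewrite -(cabsR ler01).
  rewrite cabs0 !mul0r; split => // a a0.
  by rewrite /radial_power cabs0 powR0// !mul0r.
exists (csign z); first exact: cabs_sign.
by rewrite cabs_csignK; split.
Qed.

Lemma cabs_radial_power a z : a != 0 -> cabs (radial_power a z) = cabs z `^ a.
Proof.
move=> a0; have [e e1 [_ ->]] := radial_power_polar z => //.
by rewrite cabsM e1 mulr1 cabsR// powR_ge0.
Qed.

Lemma radial_powerM a b z : a != 0 ->
  radial_power b (radial_power a z) = radial_power (a * b) z.
Proof.
move=> a0; have [->|z0] := eqVneq z 0.
  rewrite {2 3}/radial_power /csign eqxx !mulr0.
  by rewrite /radial_power /csign eqxx mulr0.
rewrite [RHS]/radial_power powRrM -cabs_radial_power// {1}/radial_power.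
congr (_ * _).
have cz0 : cabs z != 0 by apply: contra z0 => /eqP/cabs_eq0 ->.
have cza0 : real_complex R (cabs z `^ a) != 0.
  apply/eqP => /(congr1 cabs); rewrite cabsR ?powR_ge0// cabs0.
  by apply/eqP; rewrite powR_eq0 negb_and cz0.
have cs0 : csign z != 0.
  by apply/eqP => /(congr1 cabs)/eqP; rewrite cabs_sign// cabs0 oner_eq0.
rewrite {1}/csign cabs_radial_power// mulf_eq0 (negPf cza0) (negPf cs0)/=.
by rewrite mulrC mulKf.
Qed.

Lemma radial_power1 z : radial_power 1 z = z.
Proof. by rewrite /radial_power powRr1 ?cabs_ge0// cabs_csignK. Qed.

(** Radial powers preserve arguments, so one [l] serves for all exponents; with
[a = 1] the formula expresses the distance of [z] and [w] themselves. *)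
Lemma radial_power_dist z w : exists2 l : R, 0 <= l <= 1 &
  forall a, a != 0 -> cabs (radial_power a z - radial_power a w) ^+ 2 =
    l * (cabs z `^ a - cabs w `^ a) ^+ 2 +
    (1 - l) * (cabs z `^ a + cabs w `^ a) ^+ 2.
Proof.
have [e e1 [_ ze]] := radial_power_polar z.
have [f f1 [_ wf]] := radial_power_polar w.
have [l l01 lE] := sqr_cabs_sub_unit e1 f1.
by exists l => // a a0; rewrite ze// wf// lE.
Qed.

Lemma cabs_subC z w : cabs (z - w) = cabs (w - z).
Proof. by rewrite -cabsN opprB. Qed.

(** Write [r = |z|], [s = |w|], and [K] for the factor of [|z - w|] on the
right.  By [radial_power_dist] and [(r + s)^2 = (r - s)^2 + 4 r s] it
suffices that [r^a - s^a <= K (r - s)], which is [powR_sub_le_mean], and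
[r^a s^a <= K^2 r s], which is the inequality between the geometric and the
arithmetic mean of [r^p] and [s^p]. *)
Lemma radial_power_lipschitz a p z w : 1 <= a -> a - 1 <= p -> 1 <= p ->
  cabs (radial_power a z - radial_power a w) <=
  a * cabs (z - w) * ((cabs z `^ p + cabs w `^ p) / 2) `^ ((a - 1) / p).
Proof.
move=> a1 ap p1.
wlog sr : z w / cabs w <= cabs z.
  move=> H; have [/H//|/ltW/H] := leP (cabs w) (cabs z).
  by rewrite cabs_subC (cabs_subC w) (addrC (cabs w `^ p)).
have a0 : a != 0 by rewrite gt_eqF//; lra.
have [l /andP[l0 l1] lE] := radial_power_dist z w.
have E := lE _ a0; have := lE 1 (oner_neq0 _).
rewrite !radial_power1 !powRr1 ?cabs_ge0// => D.
have r0 := cabs_ge0 z; have s0 := cabs_ge0 w.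
have := powR_sub_le_mean a1 ap p1 s0 sr.
set b := (a - 1) / p; set A := (_ / 2) => sub_le.
have A0 : 0 <= A by rewrite divr_ge0// addr_ge0 ?powR_ge0.
have K0 : 0 <= A `^ b by exact: powR_ge0.
have pb : p * b = a - 1 by rewrite /b mulrC divfK// gt_eqF//; lra.
have b0 : 0 <= b by rewrite divr_ge0//; lra.
clearbody b.
have R0 := powR_ge0 (cabs z) a; have S0 := powR_ge0 (cabs w) a.
have SR : cabs w `^ a <= cabs z `^ a.
  by apply: ge0_ler_powR; rewrite ?nnegrE//; lra.
have prod_le : cabs z `^ a * cabs w `^ a <=
    (a * A `^ b) ^+ 2 * (cabs z * cabs w).
  have a0' : 0 < a by lra.
  rewrite -(mulr_powRB1 r0 a0') -(mulr_powRB1 s0 a0') mulrACA mulrC.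
  rewrite ler_wpM2r ?mulr_ge0// -pb !powRrM -powRM ?powR_ge0// exprMn.
  apply: (@le_trans _ _ ((A ^+ 2) `^ b)).
    apply: ge0_ler_powR; rewrite ?nnegrE ?sqr_ge0//.
      exact: mulr_ge0 (powR_ge0 _ _) (powR_ge0 _ _).
    rewrite /A; move: (cabs z `^ p) (cabs w `^ p) => x y.
    by have := sqr_ge0 (x - y); nra.
  by rewrite expr2 powRM// ler_peMl ?mulr_ge0// expr2; nra.
rewrite -ler_sqr ?nnegrE ?mulr_ge0 ?cabs_ge0//; try lra.
rewrite E mulrAC exprMn D.
have d_le : (cabs z `^ a - cabs w `^ a) ^+ 2 <=
    (a * A `^ b) ^+ 2 * (cabs z - cabs w) ^+ 2.
  rewrite -exprMn ler_sqr ?nnegrE ?subr_ge0//; first by rewrite mulrAC.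
  by rewrite !mulr_ge0 ?subr_ge0//; lra.
move: d_le prod_le l0 l1; set P := cabs z `^ a; set Q := cabs w `^ a.
set K2 := (a * _) ^+ 2 => d_le prod_le l0 l1.
have s_le : (P + Q) ^+ 2 <= K2 * (cabs z + cabs w) ^+ 2 by nra.
have l1' : 0 <= 1 - l by lra.
have := lerD (ler_wpM2l l0 d_le) (ler_wpM2l l1' s_le).
by move/le_trans; apply; rewrite mulrDr !(mulrCA K2).
Qed.

(** The power [a] of the squared distance is at most the combination, with
weights [l] and [1 - l], of the values for [l = 1] and [l = 0].  There the
inequality follows from [powR_superadditive] and from [powR_midpoint]. *)
Lemma radial_power_expand a z w : 1 <= a ->
  2 `^ (1 - a) * cabs (z - w) `^ a <=
  cabs (radial_power a z - radial_power a w).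
Proof.
move=> a1.
wlog sr : z w / cabs w <= cabs z.
  move=> H; have [/H//|/ltW/H] := leP (cabs w) (cabs z).
  by rewrite cabs_subC (cabs_subC (radial_power a w)).
have a0 : a != 0 by rewrite gt_eqF//; lra.
have [l l01 lE] := radial_power_dist z w.
have E := lE _ a0; have := lE 1 (oner_neq0 _).
rewrite !radial_power1 !powRr1 ?cabs_ge0// => D.
have r0 := cabs_ge0 z; have s0 := cabs_ge0 w.
have sqr_powR (x : R) : 0 <= x -> (x ^+ 2) `^ a = (x `^ a) ^+ 2.
  by move=> x0; rewrite !expr2 powRM.
rewrite -ler_sqr ?nnegrE ?mulr_ge0 ?powR_ge0 ?cabs_ge0//.
rewrite E exprMn -sqr_powR ?cabs_ge0// D.
have c0 := powR_ge0 2 (1 - a).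
have c1 : 2 `^ (1 - a) <= 1 :> R.
  by rewrite -[leRHS](powRr0 2); apply: ler_powR; lra.
have := powR_convex a1 l01 (sqr_ge0 (cabs z - cabs w))
  (sqr_ge0 (cabs z + cabs w)).
rewrite !sqr_powR ?subr_ge0 ?addr_ge0// => cvx.
have := ler_wpM2l (sqr_ge0 (2 `^ (1 - a))) cvx => /le_trans; apply.
have d_le : (2 `^ (1 - a) * (cabs z - cabs w) `^ a) ^+ 2 <=
    (cabs z `^ a - cabs w `^ a) ^+ 2.
  have sup := powR_superadditive a1 s0 sr.
  have P0 := powR_ge0 (cabs z - cabs w) a.
  rewrite ler_sqr ?nnegrE ?mulr_ge0//; nra.
have s_le : (2 `^ (1 - a) * (cabs z + cabs w) `^ a) ^+ 2 <=
    (cabs z `^ a + cabs w `^ a) ^+ 2.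
  rewrite ler_sqr ?nnegrE ?mulr_ge0 ?addr_ge0 ?powR_ge0//.
  exact: powR_midpoint.
case/andP: l01 => l0 l1; have l1' : 0 <= 1 - l by lra.
have := lerD (ler_wpM2l l0 d_le) (ler_wpM2l l1' s_le).
rewrite !exprMn; lra.
Qed.

End ComplexPlane.

(** * Estimates for the Mazur map *)

Section MazurEstimates.
Context {R : realType} {n : nat}.
Implicit Types (p q c : R) (x y : 'rV[R[i]]_n).

Lemma lpnorm_le p c x : 0 < p -> 0 <= c ->
  \sum_i cabs (x 0 i) `^ p <= c `^ p -> lpnorm p x <= c.
Proof.
move=> p0 c0; rewrite -lpnormX// => H.
rewrite leNgt; apply/negP => /(gt0_ltr_powR p0).
by rewrite !nnegrE lpnorm_ge0 c0 ltNge H => /(_ isT isT).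
Qed.

Lemma lpnorm_ge p c x : 0 < p -> 0 <= c ->
  c `^ p <= \sum_i cabs (x 0 i) `^ p -> c <= lpnorm p x.
Proof.
move=> p0 c0; rewrite -lpnormX// => H.
rewrite leNgt; apply/negP => /(gt0_ltr_powR p0).
by rewrite !nnegrE lpnorm_ge0 c0 ltNge H => /(_ isT isT).
Qed.

Lemma mazur_vecE p q x i : mazur_vec p q x 0 i = radial_power (p / q) (x 0 i).
Proof. by rewrite mxE. Qed.

Lemma mazur_vecBE p q x y i : (mazur_vec p q x - mazur_vec p q y) 0 i =
  radial_power (p / q) (x 0 i) - radial_power (p / q) (y 0 i).
Proof. by rewrite !mxE. Qed.

Lemma mazur_vecK p q x : 0 < p -> 0 < q ->
  mazur_vec q p (mazur_vec p q x) = x.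
Proof.
move=> p0 q0; apply/rowP => i.
rewrite !mazur_vecE radial_powerM ?mulf_neq0 ?invr_eq0 ?gt_eqF//.
rewrite mulf_div (mulrC q) divff ?radial_power1//.
by rewrite mulf_neq0 ?gt_eqF.
Qed.

(** Hölder's inequality with exponents [p / q] and its conjugate, carried out by
applying [powR_young] to each coordinate after dividing by the norm [D] of
[x - y].  The second factor sums to 1 because it is built from the means
of the [p]-th powers of the coordinates of [x] and [y]. *)
Lemma mazur_vec_lipschitz p q x y : 1 <= q -> q <= p ->
  lpnorm p x = 1 -> lpnorm p y = 1 ->
  lpnorm q (mazur_vec p q x - mazur_vec p q y) <= p / q * lpnorm p (x - y).
Proof.
move=> q1 qp x1 y1; have q0 : 0 < q := lt_le_trans ltr01 q1.
have p0 : 0 < p := lt_le_trans q0 qp.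
have := lpnormX x p0; rewrite x1 powR1 => /esym{}x1.
have := lpnormX y p0; rewrite y1 powR1 => /esym{}y1.
have D_eq0 : lpnorm p (x - y) = 0 -> x = y.
  by move=> /(lpnorm_eq0 p0)/eqP; rewrite subr_eq0 => /eqP.
have DX := lpnormX (x - y) p0; have D0 := lpnorm_ge0 p (x - y).
set D := lpnorm p (x - y) in D_eq0 DX D0 *; clearbody D.
have a1 : 1 <= p / q by rewrite ler_pdivlMr// mul1r.
have a0 : 0 <= p / q by lra.
have [D00|Dn0] := eqVneq D 0.
  by rewrite (D_eq0 D00) subrr lpnorm0// D00 mulr0.
have {Dn0}D0' : 0 < D by rewrite lt_neqAle eq_sym Dn0.
apply: lpnorm_le => //; first exact: mulr_ge0.
pose A i := (cabs (x 0 i) `^ p + cabs (y 0 i) `^ p) / 2.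
have A0 i : 0 <= A i by rewrite divr_ge0// addr_ge0 ?powR_ge0.
have sumA : \sum_i A i = 1.
  rewrite -mulr_suml big_split/= x1 y1; lra.
have t01 : 0 <= q / p <= 1.
  by rewrite ler_pdivrMr// mul1r qp divr_ge0 ?(ltW q0) ?(ltW p0).
have Dp0 : 0 < D `^ p by apply: powR_gt0.
have key i : cabs ((mazur_vec p q x - mazur_vec p q y) 0 i) `^ q <=
    (p / q * D) `^ q *
    (q / p * (cabs ((x - y) 0 i) `^ p / D `^ p) + (1 - q / p) * A i).
  rewrite mazur_vecBE (_ : (x - y) 0 i = x 0 i - y 0 i); last by rewrite !mxE.
  set d := cabs (x 0 i - y 0 i); have d0 : 0 <= d by apply: cabs_ge0.
  have ap : p / q - 1 <= p.
    by rewrite lerBlDr ler_pdivrMr//; nra.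
  have lip := radial_power_lipschitz (x 0 i) (y 0 i) a1 ap (le_trans q1 qp).
  apply: (@le_trans _ _ ((p / q * d * A i `^ ((p / q - 1) / p)) `^ q)).
    apply: ge0_ler_powR; rewrite ?nnegrE ?cabs_ge0 ?(ltW q0)//.
    exact: mulr_ge0 (mulr_ge0 a0 d0) (powR_ge0 _ _).
  rewrite (powRM _ (mulr_ge0 a0 d0) (powR_ge0 _ _)) (powRM _ a0 d0).
  rewrite (powRM _ a0 D0) -powRrM -[leLHS]mulrA -[leRHS]mulrA.
  rewrite ler_wpM2l ?powR_ge0//.
  have -> : (p / q - 1) / p * q = 1 - q / p by field; rewrite !gt_eqF.
  have young := powR_young (divr_ge0 (powR_ge0 d p) (ltW Dp0)) (A0 i) t01.
  apply: le_trans (ler_wpM2l (powR_ge0 D q) young).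
  rewrite mulrA ler_wpM2r ?powR_ge0//.
  have pq : p * (q / p) = q by rewrite mulrC divfK// gt_eqF.
  have -> : (d `^ p / D `^ p) `^ (q / p) = d `^ q / D `^ q.
    by rewrite -!powRN powRM ?powR_ge0// -!powRrM mulNr pq.
  by rewrite mulrCA divff ?mulr1// gt_eqF// powR_gt0.
apply: le_trans (ler_sum _ (fun i _ => key i)) _.
rewrite -mulr_sumr big_split/= -!mulr_sumr -mulr_suml sumA -DX.
by rewrite divff ?gt_eqF// !mulr1 subrKC mulr1.
Qed.

Lemma mazur_vec_expand p q x y : 0 < q -> q <= p ->
  2 `^ (1 - p / q) * lpnorm p (x - y) `^ (p / q) <=
  lpnorm q (mazur_vec p q x - mazur_vec p q y).
Proof.
move=> q0 qp; have p0 : 0 < p by lra.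
have a1 : 1 <= p / q by rewrite ler_pdivlMr// mul1r.
apply: lpnorm_ge => //; first by rewrite mulr_ge0 ?powR_ge0.
move: (lpnorm p (x - y)) (lpnormX (x - y) p0) => D DX.
rewrite powRM ?powR_ge0// -[(D `^ _) `^ _]powRrM divfK ?gt_eqF// DX mulr_sumr.
apply: ler_sum => i _.
rewrite mazur_vecBE (_ : (x - y) 0 i = x 0 i - y 0 i); last by rewrite !mxE.
have H := radial_power_expand (x 0 i) (y 0 i) a1.
apply: le_trans (ge0_ler_powR (ltW q0) _ _ H).
- by rewrite powRM ?powR_ge0// -[(cabs _ `^ _) `^ _]powRrM divfK ?gt_eqF.
- by rewrite nnegrE mulr_ge0 ?powR_ge0.
- by rewrite nnegrE cabs_ge0.
Qed.

End MazurEstimates.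

Section MazurSphere.
Context {R : realType} {n : nat} {p q : R} (hp : 1 <= p) (hq : 1 <= q).
Implicit Types x y : sphere n hp.
Let m : sphere n hp -> sphere n hq := mazur hq.

Let p0 : 0 < p := lt_le_trans ltr01 hp.
Let q0 : 0 < q := lt_le_trans ltr01 hq.

Lemma mazur_lipschitz x y : q <= p -> mdist (m x) (m y) <= p / q * mdist x y.
Proof.
move=> qp; rewrite !mdist_sphereE.
by apply: mazur_vec_lipschitz => //; apply/eqP; exact: sphere_valP.
Qed.

Lemma mazur_expand x y : q <= p ->
  2 `^ (1 - p / q) * mdist x y `^ (p / q) <= mdist (m x) (m y).
Proof. by move=> qp; rewrite !mdist_sphereE; exact: mazur_vec_expand. Qed.

(** [mazur_vec_expand] for the inverse map, solved for the distance of the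
images. *)
Lemma mazur_holder x y : p <= q ->
  mdist (m x) (m y) <= 2 `^ (1 - p / q) * mdist x y `^ (p / q).
Proof.
move=> pq; rewrite !mdist_sphereE.
have := @mazur_vec_expand R n q p (m x) (m y) p0 pq.
rewrite !mazur_vecK//.
set e := lpnorm q _; have e0 : 0 <= e by exact: lpnorm_ge0.
set d := lpnorm p _; have d0 : 0 <= d by exact: lpnorm_ge0.
clearbody e d => H.
have a0 : 0 <= p / q by rewrite divr_ge0// ltW.
have := ge0_ler_powR a0 _ _ H.
rewrite !nnegrE mulr_ge0 ?powR_ge0// d0 => /(_ isT isT).
have qp1 : q / p * (p / q) = 1 by field; rewrite !gt_eqF.
rewrite powRM ?powR_ge0// -!powRrM qp1 powRr1// mulrBl mul1r qp1.
have c0 : 0 < 2 `^ (1 - p / q) :> R by rewrite powR_gt0.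
move=> /(ler_wpM2l (ltW c0)); apply: le_trans; rewrite mulrA -powRD.
  by rewrite -[1 - p / q]opprB addNr powRr0 mul1r.
by rewrite pnatr_eq0 implybT.
Qed.

(** [mazur_vec_lipschitz] for the inverse map. *)
Lemma mazur_colipschitz x y : p <= q ->
  p / q * mdist x y <= mdist (m x) (m y).
Proof.
move=> pq; rewrite !mdist_sphereE.
have := @mazur_vec_lipschitz R n q p (m x) (m y) hp pq
  (eqP (sphere_valP _)) (eqP (sphere_valP _)).
rewrite !mazur_vecK// => H.
have a0 : 0 < p / q by rewrite divr_gt0.
apply: le_trans (ler_wpM2l (ltW a0) H) _; rewrite mulrA.
rewrite mulf_div (mulrC q) divff ?mul1r//.
by rewrite mulf_neq0 ?gt_eqF.
Qed.

End MazurSphere.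

(** * Sharpness from families of pairs *)

Section Moduli.
Local Open Scope classical_set_scope.
Context {R : realType} {M N : metricType R} (f : M -> N).

Lemma omega_ge (x y : M) t : mdist x y <= t ->
  ((mdist (f x) (f y))%:E <= omega f t)%E.
Proof. by move=> xy; apply: ereal_sup_ubound; exists x, y. Qed.

Lemma rho_le (x y : M) t : t <= mdist x y ->
  (rho f t <= (mdist (f x) (f y))%:E)%E.
Proof. by move=> xy; apply: ereal_inf_lbound; exists x, y. Qed.

Lemma omega_le t (c : R) :
  (forall x y, mdist x y <= t -> mdist (f x) (f y) <= c) ->
  (omega f t <= c%:E)%E.
Proof.
by move=> H; apply: ge_ereal_sup => _ [x [y [xy ->]]]; rewrite lee_fin H.
Qed.

Lemma rho_ge t (c : R) :
  (forall x y, t <= mdist x y -> c <= mdist (f x) (f y)) ->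
  (c%:E <= rho f t)%E.
Proof.
by move=> H; apply: le_ereal_inf_tmp => _ [x [y [xy ->]]]; rewrite lee_fin H.
Qed.

(** An estimate with exponent [g'] compares [u / s^g] with a multiple of
[s^(g' - g)]; let [h] tend to 0.  If [g' = g] this compares constants; in
the other cases the factor tending to 0 yields a contradiction with [0 < L], or
with positivity of the constant of the lower estimate. *)
Lemma sharp_of_family (s u : R -> R) (L g : R) : 0 < L ->
  (forall h, 0 < h < 1 ->
    exists x y : M, mdist x y = s h /\ mdist (f x) (f y) = u h) ->
  (forall h, 0 < h < 1 -> 0 < s h <= 2) ->
  s h @[h --> 0^'+] --> 0 ->
  u h / s h `^ g @[h --> 0^'+] --> L ->
  upper_sharp (omega f) L g /\ lower_sharp (rho f) L g.
Proof.
move=> L0 real s02 s_to0 ratio.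
have near01 (P : R -> Prop) : (forall h, 0 < h < 1 -> P h) ->
    \forall h \near 0^'+, P h.
  move=> HP; near=> h; apply: HP; apply/andP; split; near: h.
    exact: nbhs_right_gt.
  exact: nbhs_right_lt.
have s_right : s h @[h --> 0^'+] --> 0^'+.
  have s_gt0 : \forall h \near 0^'+, 0 < s h by apply: near01 => h /s02/andP[].
  by move=> A /s_to0 sA; apply: filterS2 sA s_gt0 => h; apply.
have s_pow e : 0 < e -> s h `^ e @[h --> 0^'+] --> 0.
  by move=> e0; apply: cvg_comp s_right (powR_cvg0 e0).
have up C' g' : upper_estimate (omega f) C' g' ->
    \forall h \near 0^'+, u h / s h `^ g <= C' * s h `^ (g' - g).
  move=> est; apply: near01 => h h01; have /andP[s0 s2] := s02 _ h01.
  have [x [y [xy fxy]]] := real _ h01.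
  have := est (s h); rewrite s2 ltW// => /(_ isT).
  move=> /(le_trans (omega_ge _ )) => /(_ x y); rewrite xy lexx => /(_ isT).
  rewrite lee_fin fxy ler_pdivrMr ?powR_gt0// -mulrA -powRD ?subrK//.
  by rewrite (gt_eqF s0) implybT.
have low C' g' : lower_estimate (rho f) C' g' ->
    \forall h \near 0^'+, C' <= (u h / s h `^ g) * s h `^ (g - g').
  move=> est; apply: near01 => h h01; have /andP[s0 s2] := s02 _ h01.
  have [x [y [xy fxy]]] := real _ h01.
  have := est (s h); rewrite s2 ltW// => /(_ isT) est_h.
  have := le_trans est_h (@rho_le x y (s h) _); rewrite xy lexx => /(_ isT).
  rewrite lee_fin fxy powRB ?(gt_eqF s0) ?implybT//.
  rewrite mulrA divfK ?gt_eqF ?powR_gt0// ler_pdivlMr// powR_gt0//.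
split; split.
- move=> C' /up; rewrite subrr.
  under eq_near do rewrite powRr0 mulr1.
  exact: cvgr_to_le.
- move=> g' C' gg' /up H.
  have d0 : 0 < g' - g by rewrite subr_gt0.
  have lim0 : C' * s h `^ (g' - g) @[h --> 0^'+] --> C' * 0.
    by apply: cvgM; [exact: cvg_cst|exact: s_pow].
  have : L <= C' * 0 by apply: ler_cvg_to ratio lim0 H.
  by rewrite mulr0 leNgt L0.
- move=> C' /low; rewrite subrr.
  under eq_near do rewrite powRr0 mulr1.
  exact: cvgr_to_ge.
- move=> g' C' gg' C'0 /low H.
  have d0 : 0 < g - g' by rewrite subr_gt0.
  have : C' <= L * 0 by apply: cvgr_to_ge (cvgM ratio (s_pow _ d0)) H.
  by rewrite mulr0 leNgt C'0.
Unshelve. all: by end_near. Qed.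

End Moduli.

(** * Real vectors supported on two coordinates *)

Section Coord2.
Context {R : realType} {n : nat} (hn : (2 <= n)%N).
Implicit Types (a p q u v : R).

Definition coord2 u v : 'rV[R[i]]_n :=
  \row_(i < n) real_complex R (nth 0 [:: u; v] i).

Lemma coord2B u v u' v' : coord2 u v - coord2 u' v' = coord2 (u - u') (v - v').
Proof.
apply/rowP => i; rewrite !mxE -rmorphB/=; congr (real_complex R _).
by case: (val i) => [|[|k]]//=; rewrite !nth_nil subrr.
Qed.

Lemma cabs_real u : cabs (real_complex R u) = `|u|.
Proof. by rewrite /cabs/= expr0n addr0 sqrtr_sqr. Qed.

Lemma lpnorm_coord2 p u v : 0 < p ->
  lpnorm p (coord2 u v) = (`|u| `^ p + `|v| `^ p) `^ p^-1.
Proof.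
move=> p0; congr (_ `^ _); under eq_bigr do rewrite mxE cabs_real.
case: n hn => [|[|k]]// _; rewrite !big_ord_recl big1 ?addr0// => i _.
by rewrite /= nth_nil normr0 powR0// gt_eqF.
Qed.

Lemma radial_power_real a u : a != 0 ->
  radial_power a (real_complex R u) = real_complex R (Num.sg u * `|u| `^ a).
Proof.
move=> a0; rewrite /radial_power cabs_real mulrC [RHS]rmorphM/=; congr (_ * _).
rewrite /csign; have [->|u0] := eqVneq u 0; first by rewrite eqxx sgr0.
have -> : (real_complex R u == 0) = false.
  by apply/negbTE; rewrite fmorph_eq0.
by rewrite cabs_real -fmorphV -rmorphM/= {1}(numEsg u) mulfK// normr_eq0.
Qed.

Lemma mazur_vec_coord2 p q u v : p / q != 0 ->
  mazur_vec p q (coord2 u v) =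
  coord2 (Num.sg u * `|u| `^ (p / q)) (Num.sg v * `|v| `^ (p / q)).
Proof.
move=> a0; apply/rowP => i; rewrite mazur_vecE !mxE radial_power_real//.
congr (real_complex R _).
by case: (val i) => [|[|k]]//=; rewrite !nth_nil sgr0 mul0r.
Qed.

Lemma mazur_dist_coord2 p q (hp : 1 <= p) (hq : 1 <= q) u v u' v' :
  let m : sphere n hp -> sphere n hq := mazur hq in
  let phi u := Num.sg u * `|u| `^ (p / q) in
  `|u| `^ p + `|v| `^ p = 1 -> `|u'| `^ p + `|v'| `^ p = 1 ->
  exists x y : sphere n hp,
    mdist x y = (`|u - u'| `^ p + `|v - v'| `^ p) `^ p^-1 /\
    mdist (m x) (m y) =
      (`|phi u - phi u'| `^ q + `|phi v - phi v'| `^ q) `^ q^-1.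
Proof.
move=> m phi uv uv'; have p0 : 0 < p := lt_le_trans ltr01 hp.
have q0 : 0 < q := lt_le_trans ltr01 hq.
have sph (a b : R) : `|a| `^ p + `|b| `^ p = 1 -> lpnorm p (coord2 a b) == 1.
  by move=> ab; rewrite lpnorm_coord2// ab powR1.
exists (Sphere hp (sph _ _ uv)), (Sphere hp (sph _ _ uv')).
rewrite !mdist_sphereE /= coord2B lpnorm_coord2//; split=> //.
by rewrite !mazur_vec_coord2 ?coord2B ?lpnorm_coord2//
  mulf_neq0 ?invr_eq0 ?gt_eqF.
Qed.

End Coord2.

(** * The two extremal families *)

Section Sharp.
Local Open Scope classical_set_scope.
Context {R : realType} {n : nat} (hn : (2 <= n)%N).
Context {p q : R} (hp : 1 <= p) (hq : 1 <= q).
Let m : sphere n hp -> sphere n hq := mazur hq.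

Let p0 : 0 < p := lt_le_trans ltr01 hp.
Let q0 : 0 < q := lt_le_trans ltr01 hq.

Let powR_root (r c : R) : 0 < r -> 0 <= c -> (c `^ r) `^ r^-1 = c.
Proof. by move=> r0 c0; rewrite -powRrM divff ?gt_eqF// powRr1. Qed.

Let powR_rootV (r c : R) : 0 < r -> 0 <= c -> (c `^ r^-1) `^ r = c.
Proof. by move=> r0 c0; rewrite -powRrM mulVf ?gt_eqF// powRr1. Qed.

(** The two points differ by a sign in a small coordinate [h]; the ratio
[2 h^a / (2 h)^a] is constant. *)
Lemma sharp_opposite :
  upper_sharp (omega m) (2 `^ (1 - p / q)) (p / q) /\
  lower_sharp (rho m) (2 `^ (1 - p / q)) (p / q).
Proof.
apply: (@sharp_of_family _ _ _ m (fun h => 2 * h) (fun h => 2 * h `^ (p / q))).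
- by rewrite powR_gt0.
- move=> h /andP[h0 h1]; have hp01 : h `^ p <= 1.
    by rewrite -[leRHS](powRr0 h); apply: ger_powR; rewrite ?h0 ltW.
  have b0 : 0 <= 1 - h `^ p by rewrite subr_ge0.
  have bE : `|(1 - h `^ p) `^ p^-1| `^ p = 1 - h `^ p.
    by rewrite ger0_norm ?powR_ge0// powR_rootV.
  have [||x [y [xy mxy]]] := @mazur_dist_coord2 R n hn p q hp hq
    h ((1 - h `^ p) `^ p^-1) (- h) ((1 - h `^ p) `^ p^-1).
  + by rewrite bE gtr0_norm// subrKC.
  + by rewrite bE normrN gtr0_norm// subrKC.
  have dbl (c : R) : `|c - - c| = 2 * `|c|.
    have -> : c - - c = 2 * c by ring.
    by rewrite normrM ger0_norm.
  exists x, y; split.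
    rewrite xy subrr normr0 [0 `^ p]powR0 ?gt_eqF// addr0 dbl gtr0_norm//.
    by rewrite powR_root// mulr_ge0// ltW.
  rewrite mxy subrr normr0 [0 `^ q]powR0 ?gt_eqF// addr0 sgrN normrN mulNr dbl.
  rewrite gtr0_sg// mul1r (gtr0_norm h0) ger0_norm ?powR_ge0// powR_root//.
  by rewrite mulr_ge0// powR_ge0.
- by move=> h /andP[h0 h1]; apply/andP; split; lra.
- rewrite -[X in _ --> X](mulr0 2).
  apply: cvgM; first exact: cvg_cst.
  by apply: cvg_at_right_filter; exact: cvg_id.
apply: (@cvg_trans _ (2 `^ (1 - p / q) @[h --> (0 : R)^'+])); last first.
  exact: cvg_cst.
apply: near_eq_cvg; near=> h.
have h0 : 0 < h by near: h; exact: nbhs_right_gt.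
rewrite powRM ?(ltW h0)// powRB ?pnatr_eq0 ?implybT// powRr1//.
by rewrite -mulf_div divff ?mulr1// gt_eqF// powR_gt0.
Unshelve. all: by end_near. Qed.

(** The derivative at 0 of [h |-> (1 + h)^t - (1 - h)^t]. *)
Lemma cvg_powR_symdiff (t : R) :
  ((1 + h) `^ t - (1 - h) `^ t) / h @[h --> 0^'+] --> t + t.
Proof.
apply: cvg_dnbhs_at_right.
have d1 : is_derive (0 : R) 1 (fun h : R => (1 + h) `^ t) t.
  have i1 : is_derive (0 : R) 1 (fun h : R => 1 + h) (0 + 1).
    by apply: is_deriveD.
  have i2 : is_derive (1 + 0 : R) 1 (fun x : R => x `^ t) t.
    have := @is_derive1_powR R t (1 + 0); rewrite addr0 powR1 mulr1; exact.
  have := @is_derive1_comp R (fun x => x `^ t) (fun h => 1 + h) 0 _ _ i2 i1.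
  by rewrite add0r mulr1.
have d2 : is_derive (0 : R) 1 (fun h : R => (1 - h) `^ t) (- t).
  have i1 : is_derive (0 : R) 1 (fun h : R => 1 - h) (0 - 1).
    by apply: is_deriveB.
  have i2 : is_derive (1 - 0 : R) 1 (fun x : R => x `^ t) t.
    have := @is_derive1_powR R t (1 - 0); rewrite subr0 powR1 mulr1; exact.
  have := @is_derive1_comp R (fun x => x `^ t) (fun h => 1 - h) 0 _ _ i2 i1.
  by rewrite sub0r mulrN1.
have [dble dE] := is_deriveB d1 d2.
rewrite opprK in dE; rewrite -dE.
apply: cvg_trans dble; apply: near_eq_cvg; near=> h.
transitivity (h^-1 * (((1 + (h * 1 + 0)) `^ t - (1 - (h * 1 + 0)) `^ t) -
  ((1 + 0) `^ t - (1 - 0) `^ t))); first by [].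
by rewrite mulr1 !addr0 !subr0 subrr subr0 mulrC.
Unshelve. all: by end_near. Qed.

(** The distance of the points below for [t = 1 / p], and of their images for
[t = 1 / q]. *)
Let sd (t h : R) : R := (1 + h) `^ t - (1 - h) `^ t.

(** In the limit this is the equality case of the Lipschitz bound for the map,
if [q <= p], or for its inverse, if [p <= q]: the difference [x - y] has nearly
the same modulus, relative to [x], in both coordinates, as equality in Hölder's
inequality requires. *)
Lemma sharp_swap :
  upper_sharp (omega m) (p / q) 1 /\ lower_sharp (rho m) (p / q) 1.
Proof.
have sd_gt0 t h : 0 < t -> 0 < h < 1 -> 0 < sd t h.
  move=> t0 /andP[h0 h1]; rewrite subr_gt0.
  by apply: gt0_ltr_powR; rewrite ?nnegrE//; lra.
have swap r h : 1 <= r -> 0 < h < 1 ->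
    let al := ((1 + h) / 2) `^ r^-1 in let be := ((1 - h) / 2) `^ r^-1 in
    (`|al - be| `^ r + `|be - al| `^ r) `^ r^-1 = sd r^-1 h.
  move=> r1 h01 al be; have r0 : 0 < r := lt_le_trans ltr01 r1.
  have := sd_gt0 r^-1 h; rewrite invr_gt0 => /(_ r0 h01) sd0.
  case/andP: h01 => h0 h1.
  rewrite distrC -mulr2n -mulr_natl powRM ?powR_ge0// powR_root//.
  have -> : be - al = - (2^-1 `^ r^-1 * sd r^-1 h).
    rewrite /al /be !powRM ?invr_ge0//; [|lra|lra].
    by rewrite -mulrBl mulrC -mulrN opprB.
  rewrite normrN normrM ger0_norm ?powR_ge0// (gtr0_norm sd0) mulrA.
  by rewrite -powRM ?invr_ge0// divff ?powR1 ?mul1r.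
have real h : 0 < h < 1 -> exists x y : sphere n hp,
    mdist x y = sd p^-1 h /\ mdist (m x) (m y) = sd q^-1 h.
  move=> h01; case/andP: (h01) => h0 h1.
  have al0 : 0 < (1 + h) / 2 by rewrite divr_gt0// addr_gt0.
  have be0 : 0 < (1 - h) / 2 by rewrite divr_gt0// subr_gt0.
  have al0' := ltW al0; have be0' := ltW be0.
  have [||x [y [xy mxy]]] := @mazur_dist_coord2 R n hn p q hp hq
    (((1 + h) / 2) `^ p^-1) (((1 - h) / 2) `^ p^-1)
    (((1 - h) / 2) `^ p^-1) (((1 + h) / 2) `^ p^-1).
  + by rewrite !ger0_norm ?powR_ge0// !powR_rootV//; lra.
  + by rewrite !ger0_norm ?powR_ge0// !powR_rootV//; lra.
  exists x, y; split; first by rewrite xy swap.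
  have img (c : R) : 0 < c ->
      Num.sg (c `^ p^-1) * `|c `^ p^-1| `^ (p / q) = c `^ q^-1.
    move=> c0; rewrite gtr0_sg ?powR_gt0// mul1r ger0_norm ?powR_ge0//.
    by rewrite -powRrM mulKf// gt_eqF.
  by rewrite mxy (img _ al0) (img _ be0) swap.
have ratio t : sd t h / h @[h --> 0^'+] --> t + t by exact: cvg_powR_symdiff.
apply: (@sharp_of_family _ _ _ m (sd p^-1) (sd q^-1)) => //.
- exact: divr_gt0.
- move=> h h01; rewrite sd_gt0 ?invr_gt0//=; case/andP: h01 => h0 h1.
  have : (1 + h) `^ p^-1 <= 1 + h.
    rewrite -[leRHS]powRr1; last lra.
    by apply: ler_powR; rewrite ?invf_le1//; lra.
  have := powR_ge0 (1 - h) p^-1; rewrite /sd; lra.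
- have lim0 : sd p^-1 h / h * h @[h --> 0^'+] --> (p^-1 + p^-1) * 0.
    apply: cvgM; first exact: ratio.
    by apply: cvg_at_right_filter; exact: cvg_id.
  rewrite mulr0 in lim0; apply: cvg_trans lim0; apply: near_eq_cvg; near=> h.
  by rewrite /= divfK// gt_eqF//; near: h; exact: nbhs_right_gt.
have pVn0 : p^-1 + p^-1 != 0 by rewrite gt_eqF// addr_gt0 ?invr_gt0.
have lim : sd q^-1 h / h * (sd p^-1 h / h)^-1 @[h --> 0^'+] -->
    (q^-1 + q^-1) * (p^-1 + p^-1)^-1.
  by apply: cvgM; [exact: ratio|apply: cvgV => //; exact: ratio].
rewrite [X in _ --> X](_ : _ = (q^-1 + q^-1) * (p^-1 + p^-1)^-1); last first.
  by field; rewrite !gt_eqF// addr_gt0.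
apply: cvg_trans lim; apply: near_eq_cvg; near=> h.
have h0 : 0 < h by near: h; exact: nbhs_right_gt.
have h1 : h < 1 by near: h; exact: nbhs_right_lt.
have s0 : 0 < sd p^-1 h by rewrite sd_gt0 ?invr_gt0// h0.
rewrite powRr1 ?(ltW s0)//=; field.
by rewrite !gt_eqF.
Unshelve. all: by end_near. Qed.

End Sharp.

Theorem theorem4p2 (R : realType) (n : nat) (hn : (2 <= n)%N)
    (p q : R) (hp : 1 <= p) (hq : 1 <= q) :
  let m : sphere n hp -> sphere n hq := mazur hq in
  (q < p ->
     [/\ forall t : R, 0 <= t <= 2 -> (omega m t <= (p / q * t)%:E)%E,
         forall t : R, 0 <= t <= 2 ->
           ((2 `^ (1 - p / q) * t `^ (p / q))%:E <= rho m t)%E,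
         upper_sharp (omega m) (p / q) 1
       & lower_sharp (rho m) (2 `^ (1 - p / q)) (p / q)]) /\
  (p <= q ->
     [/\ forall t : R, 0 <= t <= 2 ->
           (omega m t <= (2 `^ (1 - p / q) * t `^ (p / q))%:E)%E,
         forall t : R, 0 <= t <= 2 -> ((p / q * t)%:E <= rho m t)%E,
         upper_sharp (omega m) (2 `^ (1 - p / q)) (p / q)
       & lower_sharp (rho m) (p / q) 1]).
Proof.
move=> m; have [up1 low1] := sharp_swap hn hp hq.
have [upa lowa] := sharp_opposite hn hp hq.
have a0 : 0 <= p / q by rewrite divr_ge0// (le_trans ler01).
have pow_le (s t : R) : 0 <= s -> s <= t ->
    2 `^ (1 - p / q) * s `^ (p / q) <= 2 `^ (1 - p / q) * t `^ (p / q).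
  move=> s0 st; rewrite ler_wpM2l ?powR_ge0//.
  by apply: ge0_ler_powR; rewrite ?nnegrE// (le_trans s0).
split=> pq; split=> // t /andP[t0 _].
- apply: omega_le => x y xy.
  apply: le_trans (mazur_lipschitz hq x y (ltW pq)) _.
  by rewrite ler_wpM2l.
- apply: rho_ge => x y xy; apply: le_trans (mazur_expand hq x y (ltW pq)).
  exact: pow_le.
- apply: omega_le => x y xy; apply: le_trans (mazur_holder hq x y pq) _.
  by apply: pow_le => //; rewrite mdist_ge0.
- apply: rho_ge => x y xy; apply: le_trans (mazur_colipschitz hq x y pq).
  by rewrite ler_wpM2l.
Qed.
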